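(* Let $k$ be a positive integer, let $p\geqslant k$ be a prime, and let $0<\varepsilon<\frac12$ be a fixed real number. Let $L$ be a positive integer with $$L>\sqrt{\frac{k^3\,3^{k-1}}{2^{k+1}\varepsilon^{2k}}}.$$ Let $D=\{d_1,\ldots,d_k\}$ be a $k$-element subset of $\mathbb{Z}_p$ which is $L$-independent in $\mathbb{Z}_p$. Then $\kappa(D)\geqslant \frac12-\varepsilon$.
   Context: For $a\in\mathbb{Z}_p$ (identified with $\{0,1,\ldots,p-1\}$), $\|a\|_p=\min\{a,p-a\}$. A set $D=\{d_1,\ldots,d_k\}\subseteq\mathbb{Z}_p$ is called $L$-independent in $\mathbb{Z}_p$ if the equation $d_1x_1+d_2x_2+\cdots+d_kx_k=0$ in $\mathbb{Z}_p$ has no solution $(x_1,\ldots,x_k)\in\mathbb{Z}_p^k$ with $0<\sum_{i=1}^k\|x_i\|_p\leqslant L$. For a real number $x$, $\|x\|$ denotes the distance from $x$ to the nearest integer, $\mathbb{T}=[0,1)$, and for a finite set $D=\{d_1,\ldots,d_k\}$ of integers (here elements of $\mathbb{Z}_p$ are taken as their representatives in $\{0,\ldots,p-1\}$), $\kappa(D)=\sup_{x\in\mathbb{T}}\min_{d_i\in D}\|x d_i\|$. *)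

(* Defs.v *)
From HB Require Import structures.
From mathcomp Require Import all_boot all_order all_algebra.
From mathcomp Require Import finmap.
From mathcomp Require Import classical_sets reals set_interval.

Set Implicit Arguments.
Unset Strict Implicit.
Unset Printing Implicit Defensive.

Import Order.TTheory GRing.Theory Num.Theory.

Local Open Scope ring_scope.
Local Open Scope classical_set_scope.

(* ['F_p] is the ring of integers modulo p only when p is prime; its elements
   coerce to their representatives in {0, ..., p - 1}. *)
Definition Zp_norm (p : nat) (a : 'F_p) : nat := minn a (p - a)%N.

(* A solution (x_1, ..., x_k) is encoded as a function indexed by the residues
   themselves; only its values on D are used. *)
Definition L_independent (p L : nat) (D : {set 'F_p}) : Prop :=
  ~ exists x : 'F_p -> 'F_p,
      \sum_(d in D) d * x d = 0 /\
      (0 < \sum_(d in D) Zp_norm (x d) <= L)%N.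

Definition dist_int (R : realType) (x : R) : R :=
  inf [set `|x - m%:~R| | m in [set: int]].

(* Since [dist_int] is at most 1/2, the default value 1/2 of the iterated
   minimum does not affect its value when D is nonempty. *)
Definition kappa (R : realType) (D : {fset int}) : R :=
  sup [set \big[Num.min/2^-1]_(d <- D) dist_int (x * d%:~R) | x in `[0, 1[ ].

Definition Zp_reps (p : nat) (D : {set 'F_p}) : {fset int} :=
  [fset (nat_of_ord d)%:Z | d in D]%fset.

(* Main.v *)
(** Evaluate at the points t/p. If every t had some d in D with td/p at distance
    at least eps from 1/2 modulo 1, then sum_d |1 + e(td/p)|^2 >= 16 eps^2 for
    all t. Weight this by |G(t)|^2, where G(t) = prod_d A(-e(td/p)) and A is a
    polynomial of degree n = floor((L-1)/k). L-independence makes all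
    frequencies of (1 + e(td/p)) G(t) distinct, so Parseval in Z_p computes
    both sides exactly and leaves 16 eps^2 S <= k T, with S and T the sums of
    the squared coefficients of A(z) and (1 - z) A(z). For the parabolic
    coefficients (j+1)(n+1-j) one has T/S = 10/((n+2)^2 + 1), which contradicts
    the lower bound on L as soon as k >= 2. When k = 1, take x = 1/(2d). *)

Require Import Defs.
From HB Require Import structures.
From mathcomp Require Import all_boot all_order all_algebra.
From mathcomp Require Import finmap.
From mathcomp Require Import classical_sets reals set_interval.
From mathcomp Require Import topology normedtype derive realfun trigo.
From mathcomp Require Import complex ring lra zify.

Set Implicit Arguments.
Unset Strict Implicit.
Unset Printing Implicit Defensive.

Import Order.TTheory GRing.Theory Num.Theory.
Import numFieldNormedType.Exports.

Local Open Scope ring_scope.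

(** * Real estimates: cosine bounds, the distance to integers, and the size of L *)

Section RealLemmas.
Variable R : realType.
Implicit Types x y eps : R.

(* [sin x / x] is [cos c] and [(1 - sin x) / (pi/2 - x)] is [cos d] for some
   [c <= x <= d], and [cos] decreases. *)
Lemma jordan_sin x : 0 <= x <= pi / 2 -> 2 * x <= pi * sin x.
Proof.
move=> /andP[x0 xpi].
have csin (a b : R) : {within `[a, b], continuous (@sin R)}%classic.
  by apply: continuous_subspaceT => z; exact: continuous_sin.
have dsin (a b z : R) : z \in `]a, b[ -> is_derive z 1 (@sin R) (cos z).
  by move=> _; exact: is_derive_sin.
have [c] := MVT_segment x0 (dsin 0 x) (csin 0 x).
rewrite in_itv/= => /andP[c0 cx]; rewrite sin0 !subr0 => sx.
have [d] := MVT_segment xpi (dsin x _) (csin x _).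
rewrite in_itv/= => /andP[xd dpi]; rewrite sin_pihalf => sd.
have pi0 : 0 < pi :> R := pi_gt0 R.
have cdc : cos d <= cos c.
  by rewrite leNgt ltr_cos ?in_itv/= -?leNgt; try (apply/andP; split); lra.
have h : 0 <= (cos c - cos d) * (pi / 2 - x) by apply: mulr_ge0; lra.
have c1 : 0 <= x * (cos c * (pi / 2) - 1) by apply: mulr_ge0 => //; lra.
by rewrite sx; lra.
Qed.

Lemma lt_dist_int x y : dist_int x < y -> exists m : int, `|x - m%:~R| < y.
Proof.
by move=> /inf_lt[|_ [m _ <-] ?]; [exists `|x - 0%:~R|, 0 | exists m].
Qed.

Lemma cosD2piz (m : int) x : cos (x + (2 * pi) * m%:~R) = cos x.
Proof.
have cosn (n : nat) y : cos (y + (2 * pi) * n%:R) = cos y.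
  elim: n => [|n IH]; first by rewrite mulr0 addr0.
  by rewrite -[RHS]IH -[n.+1%:R]natr1 mulrDr mulr1 addrA mulr_natl cosD2pi.
case: m => n; first exact: cosn.
by rewrite NegzE mulrNz mulrN -{1}(cosn n.+1 (x - _)) subrK.
Qed.

(** For y = |x - m| < 1/2 - eps, the right side is 4 cos(pi y)^2 = 4 sin(pi (1/2 - y))^2, and
    [jordan_sin] bounds this sine below by 2 (1/2 - y) > 2 eps. *)
Lemma cos_far_half x eps : 0 < eps -> dist_int x < 2^-1 - eps ->
  16 * eps ^+ 2 <= 2 + 2 * cos (2 * pi * x).
Proof.
move=> eps0 /lt_dist_int[m xm].
set y := `|_| in xm.
have -> : cos (2 * pi * x) = cos (2 * pi * y).
  rewrite -(cosD2piz (- m)) mulrNz -mulrDr /y -[in RHS](ger0_norm (_ : 0 <= 2 * pi)).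
    by rewrite -normrM cos_norm.
  by rewrite mulr_ge0 ?pi_ge0.
have y0 : 0 <= y by rewrite normr_ge0.
have pi0 : 0 < pi :> R := pi_gt0 R.
have -> : 2 * pi * y = (pi * y) *+ 2 by rewrite mulr2n; ring.
rewrite cos_mulr2n.
have -> : cos (pi * y) = sin (pi * (2^-1 - y)).
  by rewrite -cosBpihalf -cosN; congr cos; field.
have : 2 * (pi * (2^-1 - y)) <= pi * sin (pi * (2^-1 - y)).
  by apply: jordan_sin; nra.
rewrite mulrCA ler_pM2l//; set s := sin _ => hs.
rewrite mulr2n; nra.
Qed.

Lemma kappa_ge (D : {fset int}) x y : x \in `[0, 1[ -> y <= 2^-1 ->
  (forall d : int, d \in D -> y <= dist_int (x * d%:~R)) -> y <= kappa R D.
Proof.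
move=> x01 y2 yD.
apply: (@le_trans _ _ (\big[Num.min/2^-1]_(d <- D) dist_int (x * d%:~R))).
  rewrite big_seq; elim/big_rec: _ => // d z dD yz.
  by rewrite le_min yz yD.
apply: ub_le_sup; last by exists x.
(* The default value 1/2 of the iterated minimum bounds the set whose supremum is taken. *)
exists 2^-1 => _ [z _ <-].
elim/big_rec: _ => // d w _ w2.
by rewrite ge_min w2 orbT.
Qed.

Lemma dist_int_half : 2^-1 <= dist_int (2^-1 : R).
Proof.
apply: lb_le_inf; first by exists `|2^-1 - 0%:~R|, 0.
move=> _ [m _ <-]; rewrite ler_normr.
have [m0|m1] := lerP m 0.
  by have : m%:~R <= 0 :> R by [rewrite lerz0]; lra.
by have : 1 <= m%:~R :> R by [rewrite ler1z -gtz0_ge1]; lra.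
Qed.

(* The hypothesis on [L] is much stronger than needed: for [k >= 2] and
   [eps < 1/2] this linear bound in [1 / eps] suffices. *)
Lemma L_big_linear (k L : nat) eps : (1 < k)%N -> 0 < eps -> eps < 2^-1 ->
  Num.sqrt ((k%:R ^+ 3 * 3 ^+ (k - 1)) / (2 ^+ (k + 1) * eps ^+ (2 * k)))
    < L%:R ->
  3 * k%:R ^+ 3 < 2 * eps ^+ 2 * L%:R ^+ 2.
Proof.
move=> k1 e0 e2 hL.
have L0 : 0 <= L%:R :> R by [].
have k0 : 0 < k%:R :> R by rewrite ltr0n ltnW.
set q := _ / _ in hL.
have qL : q < L%:R ^+ 2.
  have := hL; rewrite -[L%:R in X in X -> _](ger0_norm L0) -sqrtr_sqr.
  rewrite ltr_sqrt// exprn_gt0// (le_lt_trans _ hL)//; exact: sqrtr_ge0.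
have qE : q * eps ^+ 2 = k%:R ^+ 3 / 4 * (3 / (2 * eps ^+ 2)) ^+ (k - 1).
  rewrite /q exprM.
  have -> : 2 ^+ (k + 1) = 2 ^+ (k - 1) * 4 :> R.
    by have -> : (k + 1 = (k - 1).+2)%N by [lia]; rewrite !exprSr; ring.
  have -> : (eps ^+ 2) ^+ k = (eps ^+ 2) ^+ (k - 1) * eps ^+ 2.
    by rewrite -exprSr subn1 prednK// ltnW.
  have : eps ^+ 2 != 0 by rewrite sqrf_eq0 gt_eqF.
  move: (eps ^+ 2) => a a0; rewrite !(exprMn, exprVn); field.
  by rewrite !expf_eq0 pnatr_eq0 (negPf a0) !andbF.
(* Here eps^2 < 1/4. As k - 1 >= 1, the power is also at least 6, and 6 k^3 / 4 = 3 k^3 / 2. *)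
have e6 : 6 <= 3 / (2 * eps ^+ 2).
  by rewrite ler_pdivlMr ?mulr_gt0 ?exprn_gt0//; nra.
have e6k : 6 <= (3 / (2 * eps ^+ 2)) ^+ (k - 1).
  by rewrite (le_trans e6)// ler_eXnr ?subn_gt0//; lra.
have : 3 / 2 * k%:R ^+ 3 <= q * eps ^+ 2.
  have k3 : 0 <= k%:R ^+ 3 :> R by rewrite exprn_ge0.
  by rewrite qE; nra.
have : q * eps ^+ 2 < L%:R ^+ 2 * eps ^+ 2 by rewrite ltr_pM2r ?exprn_gt0.
by lra.
Qed.
End RealLemmas.

(** * Additive characters of Z_p and Parseval's identity *)

Section Character.
Variables (C : numClosedFieldType) (p : nat) (w : C).
Hypotheses (p_prime : prime p) (w_prim : p.-primitive_root w).

Definition chi (a : 'F_p) : C := w ^+ a.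

Lemma chi_nat n : chi n%:R = w ^+ n.
Proof. by rewrite /chi val_Fp_nat// (prim_expr_mod w_prim). Qed.

Lemma chiD a b : chi (a + b) = chi a * chi b.
Proof. by rewrite -[a]natr_Zp -[b]natr_Zp -natrD !chi_nat exprD. Qed.

Lemma chi0 : chi 0 = 1.
Proof. by rewrite -[0]/(0%:R) chi_nat. Qed.

Lemma norm_chi a : `|chi a| = 1.
Proof.
apply/eqP; rewrite -(pexpr_eq1 (prime_gt0 p_prime)) ?normr_ge0// -normrX.
by rewrite /chi exprAC (prim_expr_order w_prim) expr1n normr1.
Qed.

Lemma chi_neq0 a : chi a != 0.
Proof. by rewrite -normr_eq0 norm_chi oner_neq0. Qed.

Lemma chi_conj a : (chi a)^* = chi (- a).
Proof.
apply: (mulfI (chi_neq0 a)).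
by rewrite -normCK norm_chi expr1n -chiD subrr chi0.
Qed.

Lemma chi_eq1 a : (chi a == 1) = (a == 0).
Proof.
rewrite -[1](expr0 w) /chi (eq_prim_root_expr w_prim) mod0n -val_eqE /=.
by rewrite modn_small// -[X in (_ < X)%N](Fp_cast p_prime).
Qed.

Lemma chi_exp a j : chi a ^+ j = chi (a * j%:R).
Proof.
elim: j => [|j IH]; first by rewrite mulr0 chi0.
by rewrite exprSr IH -[j.+1%:R]natr1 mulrDr mulr1 chiD.
Qed.

Lemma sum_chi a : \sum_t chi (t * a) = p%:R *+ (a == 0).
Proof.
have [->|a0] := eqVneq a 0.
  under eq_bigr do rewrite mulr0 chi0.
  by rewrite sumr_const card_Fp.
(* Translating t by 1 multiplies the sum by chi(a), which differs from 1. *)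
have /eqP := erefl (\sum_t chi (t * a)).
rewrite {1}(reindex_inj (addrI 1)) /=.
under eq_bigr do rewrite mulrDl mul1r chiD.
rewrite -mulr_sumr -subr_eq0 -[X in _ - X]mul1r -mulrBl mulf_eq0 subr_eq0.
by rewrite chi_eq1 (negPf a0) => /eqP.
Qed.

(** Expand the square and sum over t first: orthogonality leaves only the diagonal. Injectivity is
    restricted to nonzero coefficients because the parabola below has a zero top coefficient. *)
Lemma parseval (I : finType) (P : pred I) (c : I -> C) (f : I -> 'F_p) :
  {in [pred i | P i & c i != 0] &, injective f} ->
  \sum_t `|\sum_(i | P i) c i * chi (t * f i)| ^+ 2
    = p%:R * \sum_(i | P i) `|c i| ^+ 2.
Proof.
move=> finj.
under eq_bigr => t _.
  rewrite normCK rmorph_sum mulr_sumr.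
  under eq_bigr => i _.
    rewrite mulr_suml.
    under eq_bigr => j _.
      rewrite rmorphM /= chi_conj mulrACA -chiD -mulrN -mulrDr. over.
    over.
  over.
rewrite exchange_big mulr_sumr; apply: eq_bigr => i Pi.
rewrite exchange_big (bigD1 i) //= [X in _ + X]big1 => [|j /andP[Pj ji]].
  by rewrite -mulr_sumr sum_chi subrr eqxx addr0 normCK mulrC.
rewrite -mulr_sumr sum_chi subr_eq0.
have [->|cj] := eqVneq (c j) 0; first by rewrite mul0r mul0r.
have [->|ci] := eqVneq (c i) 0; first by rewrite rmorph0 mulr0 mul0r.
by rewrite (inj_in_eq finj) ?inE ?Pi ?Pj// (negPf ji) mulr0.
Qed.

(** Distributing the product gives one term per choice J of exponents, with frequency sum_d d J(d);
    distinct choices must have distinct frequencies for [parseval] to apply. *)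
Lemma parseval_prod (D : {set 'F_p}) (N : nat) (c : 'F_p -> 'I_N.+1 -> C) :
  (forall J J' : 'F_p -> 'I_N.+1,
     (forall d, d \in D -> c d (J d) != 0) ->
     (forall d, d \in D -> c d (J' d) != 0) ->
     \sum_(d in D) d * (J d)%:R = \sum_(d in D) d * (J' d)%:R :> 'F_p ->
     {in D, J =1 J'}) ->
  \sum_t `|\prod_(d in D) \sum_j c d j * chi (t * d) ^+ j| ^+ 2
    = p%:R * \prod_(d in D) \sum_j `|c d j| ^+ 2.
Proof.
move=> cinj.
under [LHS]eq_bigr => t _.
  rewrite (big_distr_big ord0).
  under eq_bigr => J _.
    rewrite big_split /=.
    rewrite (_ : \prod_(d in D) chi _ ^+ _
                 = chi (t * \sum_(d in D) d * (J d)%:R)).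
      over.
    rewrite mulr_sumr (big_morph _ chiD chi0); apply: eq_bigr => d _.
    by rewrite chi_exp mulrA.
  over.
rewrite parseval.
  congr (_ * _); rewrite (big_distr_big ord0); apply: eq_bigr => J _.
  by rewrite normr_prod -prodrXl.
move=> J J'; rewrite !inE => /andP[JD] + /andP[JD'].
move=> /prodf_neq0 cJ /prodf_neq0 cJ' /(cinj _ _ cJ cJ') JJ'.
apply/ffunP => d; have [dD|dD] := boolP (d \in D); first exact: JJ'.
(* The choices produced by distributivity take the default [ord0] off D, so agreement on D is
   equality. *)
have out (K : {ffun 'F_p -> 'I_N.+1}) :
    K \in pffun_on ord0 (mem D) xpredT -> K d = ord0.
  move=> /pffun_onP[/fintype.subsetP sK _].
  by apply/eqP/negPn; apply: contra dD => /sK.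
by rewrite !out.
Qed.
End Character.

(** * The parabolic coefficients and their energies *)

Section Parabola.
Variable C : numClosedFieldType.

Lemma parabola_mul (N : nat) (z : C) :
  (1 - z) * \sum_(j < N) (j.+1%:R * (N%:R - j.+1%:R)) * z ^+ j
    = \sum_(j < N) (N%:R - 1 - 2 * j%:R) * z ^+ j.
Proof.
(* Truncation at m leaves the boundary term m (N - m) z^m, which vanishes at m = N. *)
suff H m : (1 - z) * \sum_(j < m) (j.+1%:R * (N%:R - j.+1%:R)) * z ^+ j
    = \sum_(j < m) (N%:R - 1 - 2 * j%:R) * z ^+ j - m%:R * (N%:R - m%:R) * z ^+ m.
  by rewrite H subrr mulr0 mul0r subr0.
elim: m => [|m IH]; first by rewrite !big_ord0 !mul0r mulr0 subr0.
by rewrite !big_ord_recr /= mulrDr IH exprS -[m.+1%:R]natr1; ring.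
Qed.

Lemma parabola_energy (N : nat) :
  30 * \sum_(j < N) (j.+1%:R * (N%:R - j.+1%:R)) ^+ 2 = N%:R * (N%:R ^+ 4 - 1) :> C.
Proof.
(* Freeing the upper limit from N permits induction; the three terms come from the sums of squares,
   cubes and fourth powers of 1, ..., m. *)
suff H m : 30 * \sum_(j < m) (j.+1%:R * (N%:R - j.+1%:R)) ^+ 2 =
   5 * N%:R ^+ 2 * m%:R * (m%:R + 1) * (2 * m%:R + 1)
   - 15 * N%:R * m%:R ^+ 2 * (m%:R + 1) ^+ 2
   + m%:R * (m%:R + 1) * (2 * m%:R + 1) * (3 * m%:R ^+ 2 + 3 * m%:R - 1) :> C.
  by rewrite H; ring.
elim: m => [|m IH]; first by rewrite big_ord0; ring.
by rewrite !big_ord_recr /= mulrDr IH -[m.+1%:R]natr1; ring.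
Qed.

Lemma parabola_diff_energy (N : nat) :
  3 * \sum_(j < N) (N%:R - 1 - 2 * j%:R) ^+ 2 = N%:R * (N%:R ^+ 2 - 1) :> C.
Proof.
suff H m : 3 * \sum_(j < m) (N%:R - 1 - 2 * j%:R) ^+ 2 =
   3 * m%:R * (N%:R - 1) ^+ 2 - 6 * (N%:R - 1) * m%:R * (m%:R - 1)
   + 2 * m%:R * (m%:R - 1) * (2 * m%:R - 1) :> C.
  by rewrite H; ring.
elim: m => [|m IH]; first by rewrite big_ord0; ring.
by rewrite !big_ord_recr /= mulrDr IH -[m.+1%:R]natr1; ring.
Qed.
End Parabola.

(** * The weighted mean-square inequality *)

Section KeyInequality.
Variables (C : numClosedFieldType) (p : nat) (w : C).
Hypotheses (p_prime : prime p) (w_prim : p.-primitive_root w).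
Local Notation chi := (@chi C p w).

Lemma sum_parabola_chi (N : nat) (a : 'F_p) :
  (1 + chi a) * \sum_(j < N) ((-1) ^+ j * (j.+1%:R * (N%:R - j.+1%:R))) * chi a ^+ j
    = \sum_(j < N) ((-1) ^+ j * (N%:R - 1 - 2 * j%:R)) * chi a ^+ j.
Proof.
have sgn (f : 'I_N -> C) : \sum_(j < N) (-1) ^+ j * f j * chi a ^+ j
    = \sum_(j < N) f j * (- chi a) ^+ j.
  by apply: eq_bigr => j _; rewrite [in RHS]exprNn mulrCA mulrA.
by rewrite !sgn -parabola_mul opprK.
Qed.

Lemma norm_sign_real (j : nat) (x : C) : x \is Num.real ->
  `|(-1) ^+ j * x| ^+ 2 = x ^+ 2.
Proof. by move=> xr; rewrite normrM normr_sign mul1r real_normK. Qed.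

(** Multiplying G by 1 + chi(t d0) raises the degree of the factor at d0 alone, hence the exponent
    bound n + 1 there and n elsewhere. *)
Lemma separation_bound (D : {set 'F_p}) (n : nat) (delta : C) :
  (forall d0 (J J' : 'F_p -> nat), d0 \in D ->
     (forall d, d \in D -> (J d <= n + (d == d0))%N) ->
     (forall d, d \in D -> (J' d <= n + (d == d0))%N) ->
     \sum_(d in D) d * (J d)%:R = \sum_(d in D) d * (J' d)%:R :> 'F_p ->
     {in D, J =1 J'}) ->
  (forall t, exists2 d, d \in D & delta <= `|1 + chi (t * d)| ^+ 2) ->
  delta * (n.+2%:R ^+ 2 + 1) <= 10 * #|D|%:R.
Proof.
(* With N = n + 2, exponents run up to n + 1: [a] has a zero last coefficient and degree n, while
   [b] uses the whole range. *)
move=> Dinj far; pose N := n.+2.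
pose a (j : 'I_N) : C := (-1) ^+ j * (j.+1%:R * (N%:R - j.+1%:R)).
pose b (j : 'I_N) : C := (-1) ^+ j * (N%:R - 1 - 2 * j%:R).
pose G t := \prod_(d in D) \sum_j a j * chi (t * d) ^+ j.
pose S := \sum_j `|a j| ^+ 2; pose T := \sum_j `|b j| ^+ 2.
have [d1 d1D _] := far 0.
have aN (j : 'I_N) : a j != 0 -> (j <= n)%N.
  move=> aj; rewrite leqNgt; apply: contra aj => nj.
  have jE : j = n.+1 :> nat by apply/eqP; rewrite eqn_leq nj -ltnS ltn_ord.
  by rewrite /a jE subrr !mulr0.
have GE : \sum_t `|G t| ^+ 2 = p%:R * S ^+ #|D|.
  rewrite (parseval_prod p_prime w_prim (c := fun=> a)) ?prodr_const//.
  move=> J J' aJ aJ' JJ' d dD.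
  apply/val_inj/(Dinj d1 (fun e => J e) (fun e => J' e) d1D _ _ JJ') => // e eD.
    exact/leq_trans/leq_addr/aN/aJ.
  exact/leq_trans/leq_addr/aN/aJ'.
have GdE d : d \in D ->
    \sum_t `|1 + chi (t * d)| ^+ 2 * `|G t| ^+ 2 = p%:R * (T * S ^+ #|D|.-1).
  move=> dD; pose c e j := if e == d then b j else a j.
  have D'E F F' : (forall e, e \in D :\ d -> F e = F' e) ->
      \prod_(e in D) F e = F d * \prod_(e in D :\ d) F' e :> C.
    by move=> FF'; rewrite (big_setD1 d)//=; congr (_ * _); apply: eq_bigr.
  under eq_bigr => t _.
    rewrite -exprMn -normrM.
    rewrite (_ : _ * _ = \prod_(e in D) \sum_j c e j * chi (t * e) ^+ j).
      over.
    rewrite /G (big_setD1 d)//= mulrA sum_parabola_chi.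
    rewrite (D'E _ (fun e => \sum_j a j * chi (t * e) ^+ j)); last first.
      by move=> e; rewrite !inE /c => /andP[/negPf-> _].
    by rewrite /c eqxx.
  rewrite (parseval_prod p_prime w_prim).
    rewrite (D'E _ (fun e => S)); last first.
      by move=> e; rewrite !inE /c => /andP[/negPf-> _].
    by rewrite /c eqxx prodr_const (cardsD1 d D) dD.
  move=> J J' cJ cJ' JJ' y yD.
  have cle (K : 'F_p -> 'I_N) e : c e (K e) != 0 -> (K e <= n + (e == d))%N.
    rewrite /c; case: (e == d) => [_|/aN]; last by rewrite addn0.
    by rewrite addn1 -ltnS ltn_ord.
  apply/val_inj/(Dinj d (fun e => J e) (fun e => J' e) dD _ _ JJ') => // e eD.
    exact/cle/cJ.
  exact/cle/cJ'.
have SE : 30 * S = N%:R * (N%:R ^+ 4 - 1).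
  rewrite -parabola_energy; congr (_ * _); apply: eq_bigr => j _.
  by rewrite norm_sign_real// rpredM ?rpredB ?realn.
have TE : 3 * T = N%:R * (N%:R ^+ 2 - 1).
  rewrite -parabola_diff_energy; congr (_ * _); apply: eq_bigr => j _.
  by rewrite norm_sign_real// !rpredB ?rpredM ?realn// real1.
have S0 : 0 < S.
  rewrite -(pmulr_rgt0 _ (_ : 0 < 30)) ?ltr0n// SE mulr_gt0 ?ltr0n//.
  by rewrite subr_gt0 exprn_egt1// ltr1n.
(* This is N^4 - 1 = (N^2 - 1)(N^2 + 1), read through [SE] and [TE]. *)
have TS : T * (N%:R ^+ 2 + 1) = 10 * S.
  apply: (@mulfI _ 3); first by rewrite pnatr_eq0.
  by rewrite mulrA TE; transitivity (30 * S); [rewrite SE; ring | ring].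
have p0 : 0 < p%:R :> C by rewrite ltr0n prime_gt0.
have D0 : (0 < #|D|)%N by apply/card_gt0P; exists d1.
(* At each t, the element of D supplied by [far] already contributes delta to the sum over D. *)
have : delta * \sum_t `|G t| ^+ 2
    <= \sum_(d in D) \sum_t `|1 + chi (t * d)| ^+ 2 * `|G t| ^+ 2.
  rewrite exchange_big mulr_sumr; apply: ler_sum => t _.
  have [d dD dt] := far t; rewrite -mulr_suml ler_wpM2r ?exprn_ge0//.
  rewrite (le_trans dt)// (bigD1 d)//= lerDl sumr_ge0// => e _.
  by rewrite exprn_ge0.
rewrite GE (eq_bigr _ GdE) sumr_const -[leRHS]mulr_natl.
rewrite -{1}(prednK D0) exprS => H.
(* Cancel the common positive factor p S^(|D| - 1). *)
have {}H : delta * S <= #|D|%:R * T.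
  rewrite -(ler_pM2r (mulr_gt0 p0 (exprn_gt0 #|D|.-1 S0))).
  have swap x y z : x * (p%:R * (y * z)) = x * y * (p%:R * z) :> C by ring.
  by move: H; rewrite !swap.
rewrite -(ler_pM2r S0) mulrAC.
have N0 : 0 <= N%:R ^+ 2 + 1 :> C by rewrite addr_ge0 ?exprn_ge0.
apply: le_trans (ler_wpM2r N0 H) _.
by rewrite -mulrA TS mulrCA mulrA.
Qed.
End KeyInequality.

(** * From L-independence to distinct frequencies *)

Section Independence.
Variable p : nat.
Hypothesis p_prime : prime p.

Lemma Zp_norm_gt0 (x : 'F_p) : (0 < Zp_norm x)%N = (x != 0).
Proof.
have xp : (x < p)%N by rewrite -[X in (_ < X)%N](Fp_cast p_prime).
by rewrite leq_min subn_gt0 xp andbT lt0n.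
Qed.

Lemma Zp_normN (x : 'F_p) : Zp_norm (- x) = Zp_norm x.
Proof.
have [->|x0] := eqVneq x 0; first by rewrite oppr0.
have xp : (x < p)%N by rewrite -[X in (_ < X)%N](Fp_cast p_prime).
have xE : (- x : 'F_p) = (p - x)%N :> nat.
  (* The modulus built into ['F_p] equals p only through [Fp_cast], so it is generalized to q before
     rewriting. *)
  suff mod_sub q : q = p -> ((q - x) %% q = p - x)%N by exact/mod_sub/Fp_cast.
  by move=> ->; rewrite modn_small// ltn_subrL lt0n x0 prime_gt0.
by rewrite /Zp_norm xE subKn ?(ltnW xp)// minnC.
Qed.

Lemma Zp_norm_sub_le (a b m : nat) : (a <= m)%N -> (b <= m)%N ->
  (Zp_norm (a%:R - b%:R : 'F_p)%R <= m)%N.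
Proof.
wlog ba : a b / (b <= a)%N.
  move=> H am bm; have [ba|/ltnW ab] := leqP b a; first exact: H.
  by rewrite -Zp_normN opprB H.
move=> am _; rewrite -natrB// /Zp_norm val_Fp_nat// geq_min.
by rewrite (leq_trans (leq_mod _ _))// (leq_trans (leq_subr _ _)).
Qed.

(* If [p <= L], the relation [d * e + e * (- d) = 0] has weight at most [p]. *)
Lemma L_independent_lt (L : nat) (D : {set 'F_p}) : (1 < #|D|)%N ->
  L_independent L D -> (L < p)%N.
Proof.
move=> /card_gt1P[d [e [dD eD de]]] indep; rewrite ltnNge.
apply/negP => pL; apply: indep.
pose x y : 'F_p := if y == d then e else if y == e then - d else 0.
have xd : x d = e by rewrite /x eqxx.
have xe : x e = - d by rewrite /x eq_sym (negPf de) eqxx.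
have x0 y : y != d -> y != e -> x y = 0 by rewrite /x => /negPf-> /negPf->.
exists x.
have D2 (V : nmodType) (F : 'F_p -> V) :
    (forall y, y != d -> y != e -> F y = 0) -> \sum_(y in D) F y = F d + F e.
  move=> F0; rewrite (bigD1 d)//= (bigD1 e) ?eD 1?eq_sym//= big1 ?addr0// => y.
  by move=> /andP[/andP[_ yd] ye]; exact: F0.
split.
  rewrite D2 => [|y yd ye]; first by rewrite xd xe mulrN mulrC subrr.
  by rewrite x0// mulr0.
rewrite [X in (0 < X <= _)%N](D2 nat) => [|y yd ye]; last first.
  by rewrite x0// /Zp_norm min0n.
rewrite xd xe Zp_normN; apply/andP; split; last first.
  (* Each of the two norms is at most p/2. *)
  by apply: leq_trans pL; rewrite /Zp_norm /GRing.add /=; lia.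
rewrite addn_gt0 !Zp_norm_gt0// -negb_and; apply: contra de.
by move=> /andP[/eqP-> /eqP->].
Qed.

(** If J and J' differ on D, then J - J' solves the equation with weight at most |D| n + 1 <= L, the
    extra 1 coming from d0. This weight is positive since the exponents are at most n + 1 <= L < p,
    so distinct ones stay distinct modulo p. *)
Lemma L_independent_inj (L n : nat) (D : {set 'F_p}) d0 (J J' : 'F_p -> nat) :
  L_independent L D -> (L < p)%N -> (#|D| * n < L)%N -> d0 \in D ->
  (forall d, d \in D -> (J d <= n + (d == d0))%N) ->
  (forall d, d \in D -> (J' d <= n + (d == d0))%N) ->
  \sum_(d in D) d * (J d)%:R = \sum_(d in D) d * (J' d)%:R :> 'F_p ->
  {in D, J =1 J'}.
Proof.
move=> indep Lp nL d0D Jn J'n JJ' d dD.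
apply/eqP/negPn/negP => Jd; apply: indep.
exists (fun y => (J y)%:R - (J' y)%:R); split.
  by under eq_bigr do rewrite mulrBr; rewrite sumrB JJ' subrr.
have D0 : (0 < #|D|)%N by apply/card_gt0P; exists d.
have np : (n.+1 < p)%N by apply: leq_ltn_trans Lp; nia.
apply/andP; split; last first.
  apply: leq_trans nL; apply: (@leq_trans (\sum_(y in D) (n + (y == d0)))).
    by apply: leq_sum => y yD; rewrite Zp_norm_sub_le ?Jn ?J'n.
  rewrite big_split /= sum_nat_const (bigD1 d0)//= eqxx big1 ?addn0 ?addn1//.
  by move=> y /andP[_ /negPf->].
rewrite (bigD1 d)//= addn_gt0 Zp_norm_gt0 subr_eq0.
apply/orP; left; apply: contra Jd => /eqP/(congr1 val) /=.
have small (K : 'F_p -> nat) : (K d <= n + (d == d0))%N -> (K d < p)%N.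
  by case: eqP => _; lia.
by move/eqP; rewrite !val_Fp_nat// !modn_small ?small ?Jn ?J'n.
Qed.
End Independence.

(** * The complex root of unity e(1/p) *)

Section RootOfUnity.
Variables (R : realType) (p : nat).
Local Open Scope complex_scope.

Definition expi (x : R) : R[i] := cos x +i* sin x.

Lemma expiX x n : expi x ^+ n = expi (x * n%:R).
Proof.
elim: n => [|n IH]; first by rewrite mulr0 /expi cos0 sin0.
rewrite exprSr IH -[n.+1%:R]natr1 mulrDr mulr1 /expi cosD sinD.
by apply/eqP; rewrite eq_complex /=; apply/andP; split; apply/eqP; ring.
Qed.

Lemma norm_1Dexpi x : `|1 + expi x| ^+ 2 = (2 + 2 * cos x)%:C.
Proof.
rewrite -add_Re2_Im2 /= add0r; congr (_ %:C).
by have := cos2Dsin2 x => h; rewrite -[2 in RHS]/(1 + 1); lra.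
Qed.

(** The order divides the prime p; order 1 would give cos(2 pi / p) = 1, impossible as 0 < 2 pi / p
    <= pi and cosine strictly decreases on [0, pi]. *)
Lemma expi_prim : prime p -> p.-primitive_root (expi (2 * pi / p%:R)).
Proof.
move=> p_prime; have p0 := prime_gt0 p_prime.
have p0R : 0 < p%:R :> R by rewrite ltr0n.
have pi0 : 0 < pi :> R := pi_gt0 R.
have p2 : 2 <= p%:R :> R by rewrite ler_nat prime_gt1.
have : expi (2 * pi / p%:R) ^+ p = 1.
  by rewrite expiX divfK ?gt_eqF// /expi mulr_natl cos2pi sin2pi.
case/(prim_order_exists p0) => m m_prim mp.
have /primeP[_ /(_ m mp)/orP[/eqP m1|/eqP mE]] := p_prime; last by rewrite -{1}mE.
have := prim_expr_order m_prim; rewrite m1 expr1 => /(congr1 (@complex.Re R))/= /eqP.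
have x0 : 0 < 2 * pi / p%:R :> R by rewrite divr_gt0// mulr_gt0.
rewrite lt_eqF// -[ltRHS](cos0 R) ltr_cos// in_itv/= ?lexx ?(ltW pi0)//.
by rewrite (ltW x0) ler_pdivrMr// mulrC ler_pM2l.
Qed.
End RootOfUnity.

(** * Evaluation at the points t/p and the final contradiction *)

Theorem theorem2 (R : realType) (k p : nat) (k_gt0 : (0 < k)%N)
    (p_prime : prime p) (k_le_p : (k <= p)%N)
    (eps : R) (eps_gt0 : 0 < eps) (eps_lt : eps < 2^-1)
    (L : nat) (L_gt0 : (0 < L)%N)
    (L_big : Num.sqrt ((k%:R ^+ 3 * 3 ^+ (k - 1))
                       / (2 ^+ (k + 1) * eps ^+ (2 * k))) < L%:R)
    (D : {set 'F_p}) (D_card : #|D| = k) (D_indep : L_independent L D) :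
  2^-1 - eps <= kappa R (Zp_reps D).
Proof.
have eps_le : 2^-1 - eps <= 2^-1 :> R by rewrite gerBl ltW.
have [k1|k1] := leqP k 1.
  have /cards1P[d DE] : #|D| == 1%N by rewrite D_card eqn_leq k1.
  (* If d = 0, then x = 1 would be a solution of positive weight at most 1 <= L. *)
  have d0 : d != 0.
    apply/eqP => d0; apply: D_indep; exists (fun=> 1); split.
      by rewrite DE big_set1 d0 mul0r.
    rewrite DE big_set1 Zp_norm_gt0// oner_neq0 /=.
    by apply: leq_trans L_gt0; rewrite geq_min.
  have d1 : 1 <= (d : nat)%:R :> R by rewrite ler1n lt0n.
  have d_gt0 : 0 < (d : nat)%:R :> R by apply: lt_le_trans d1.
  apply: (@kappa_ge _ _ (2^-1 / (d : nat)%:R)) => // [|_ /imfsetP[/= e + ->]].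
    rewrite in_itv/= divr_ge0 ?invr_ge0//= ltr_pdivrMr// mul1r.
    by lra.
  rewrite DE inE => /eqP->; rewrite divfK ?gt_eqF//.
  exact: le_trans eps_le (dist_int_half R).
have cardD1 : (1 < #|D|)%N by rewrite D_card.
have Lp := L_independent_lt p_prime cardD1 D_indep.
(* The largest n with k n < L; maximality gives L <= k (n + 1). *)
pose n := (L.-1 %/ k)%N.
have nL : (#|D| * n < L)%N.
  by rewrite D_card mulnC -[L in X in (_ < X)%N]prednK// ltnS leq_trunc_div.
have Ln : (L <= k * n.+1)%N.
  by rewrite -[L in X in (X <= _)%N]prednK// mulnC ltn_ceil.
have p0R : 0 < p%:R :> R by rewrite ltr0n prime_gt0.
rewrite leNgt; apply/negP => small_kappa.
have far t : exists2 d, d \in D &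
    ((16 * eps ^+ 2)%:C)%C <= `|1 + chi (expi (2 * pi / p%:R)) (t * d)| ^+ 2.
  (* Otherwise x = t/p would contradict the assumed upper bound on kappa. *)
  have : ~~ [forall d in D, 2^-1 - eps <= dist_int (t%:R / p%:R * (d : nat)%:R : R)].
    apply/negP => /forall_inP tD; have := small_kappa; rewrite ltNge => /negP[].
    apply: (@kappa_ge _ _ (t%:R / p%:R)) => // [|_ /imfsetP[/= d dD ->]].
      rewrite in_itv/= divr_ge0//= ltr_pdivrMr// mul1r ltr_nat.
      by rewrite -[X in (_ < X)%N](Fp_cast p_prime).
    exact: tD.
  rewrite negb_forall => /existsP[d]; rewrite negb_imply -ltNge => /andP[dD far].
  exists d => //; rewrite -[t]natr_Zp -[d]natr_Zp -natrM.
  rewrite chi_nat ?expi_prim// expiX norm_1Dexpi lecR natrM.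
  have -> : 2 * pi / p%:R * (t%:R * (d : nat)%:R)
    = 2 * pi * (t%:R / p%:R * (d : nat)%:R) :> R by field; rewrite gt_eqF.
  exact: cos_far_half.
have := separation_bound p_prime (expi_prim R p_prime)
  (fun d0 J J' => L_independent_inj p_prime D_indep Lp nL) far.
have -> : n.+2%:R ^+ 2 + 1 = ((n.+2%:R ^+ 2 + 1)%:C)%C :> R[i].
  by rewrite rmorphD rmorphXn rmorph_nat rmorph1.
have -> : 10 * #|D|%:R = ((10 * k%:R)%:C)%C :> R[i].
  by rewrite D_card rmorphM !rmorph_nat.
rewrite -rmorphM lecR.
have := L_big_linear k1 eps_gt0 eps_lt L_big; set e2 := eps ^+ 2.
set N : R := n.+1%:R; set K : R := k%:R => KL H.
have e2_ge0 : 0 <= e2 by rewrite exprn_ge0// ltW.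
have K0 : 0 <= K by [].
have N0 : 0 <= N by [].
have N1 : N ^+ 2 <= n.+2%:R ^+ 2 + 1 :> R.
  by rewrite -[n.+2%:R]natr1 -/N; nra.
have LKN : L%:R ^+ 2 <= (K * N) ^+ 2 :> R.
  by rewrite lerXn2r ?nnegrE ?mulr_ge0// -natrM ler_nat.
(* As L <= K N, this gives 16 eps^2 L^2 <= 10 K^3, while [KL] makes 10 K^3 < (20/3) eps^2 L^2. *)
have : K ^+ 2 * (16 * e2 * N ^+ 2) <= K ^+ 2 * (10 * K).
  apply: ler_wpM2l; first exact: exprn_ge0.
  by apply: le_trans H; apply: ler_wpM2l => //; exact: mulr_ge0.
have : e2 * L%:R ^+ 2 <= e2 * (K * N) ^+ 2 by rewrite ler_wpM2l.
have : 0 <= e2 * L%:R ^+ 2 by apply: mulr_ge0 => //; exact: exprn_ge0.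
have -> : K ^+ 2 * (16 * e2 * N ^+ 2) = 16 * (e2 * (K * N) ^+ 2) by ring.
have -> : K ^+ 2 * (10 * K) = 10 * K ^+ 3 by ring.
lra.
Qed.
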